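(* (Elaboration is type-preserving.) Let $M$ be a term of the surface language $\lambda_{\mathrm{eff}}^{\mathrm{let}}$ and $A$ a type. If $M$ is a well-typed program of $A$, i.e. $\emptyset;\mathsf{none}\vdash M:A\mid\langle\rangle$, then there exists a term $e$ of the intermediate language $\lambda_{\mathrm{eff}}^{\Lambda}$ such that $\emptyset;\mathsf{none}\vdash M:A\mid\langle\rangle\ \triangleright^{\emptyset}\ e$ (elaboration with the identity variable mapping) and $\emptyset;\mathsf{none}\vdash e:A\mid\langle\rangle$ (typing in $\lambda_{\mathrm{eff}}^{\Lambda}$).
   Context: **Types (shared by both languages).** Fix a set of effect operations $\mathsf{op}$. An effect $\epsilon$ is a finite set of operations; $\langle\rangle$ is the empty effect. Types: $A,B,C,D::=\alpha\mid\iota\mid A\to^{\epsilon}B$, with $\alpha$ (also $\beta,\gamma$) type variables and $\iota$ base types (bool, int, a designated base type $\bot$, ...). Type schemes: $\sigma::=A\mid\forall\alpha.\sigma$. Bold letters denote finite sequences, possibly with index set as superscript ($\boldsymbol\alpha^{I}$); index sets may be omitted; $\{\boldsymbol\alpha\}$ is the underlying set; $\mathit{ftv}$ denotes free type variables; $B[\boldsymbol A/\boldsymbol\alpha]$ is capture-avoiding simultaneous substitution (equal index sets). $\boldsymbol{\forall\boldsymbol\beta^{J}.C}^{I}$ is the sequence of the schemes $\forall\boldsymbol\beta^J.C_i$, $i\in I$. Each constant $c$ has a closed first-order type $\mathit{ty}(c)=\iota_1\to^{\langle\rangle}\cdots\to^{\langle\rangle}\iota_n$. Each operation has a signature $\mathit{ty}(\mathsf{op})=\forall\boldsymbol\alpha.A\hookrightarrow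 B$ with $\mathit{ftv}(A)\cup\mathit{ftv}(B)\subseteq\{\boldsymbol\alpha\}$. Typing contexts $\Gamma::=\emptyset\mid\Gamma,x:\sigma\mid\Gamma,\alpha$; $\mathit{dom}(\Gamma)$ is the set of declared term and type variables. $\Gamma\vdash\sigma$ iff $\mathit{ftv}(\sigma)\subseteq\mathit{dom}(\Gamma)$ (for sequences: componentwise). $\vdash\Gamma$ is generated by: $\vdash\emptyset$; if $\vdash\Gamma$, $x\notin\mathit{dom}(\Gamma)$, $\Gamma\vdash\sigma$ then $\vdash\Gamma,x:\sigma$; if $\vdash\Gamma$, $\alpha\notin\mathit{dom}(\Gamma)$ then $\vdash\Gamma,\alpha$. Terms are taken up to renaming of bound variables. **Surface language $\lambda_{\mathrm{eff}}^{\mathrm{let}}$.** Terms $M::=x\mid c\mid\lambda x.M\mid M_1\,M_2\mid\mathsf{let}\ x=M_1\ \mathsf{in}\ M_2\mid\#\mathsf{op}(M)\mid\mathsf{handle}\ M\ \mathsf{with}\ H\mid\mathsf{resume}\ M$; handlers $H::=\mathsf{return}\ x\to M\mid H;\mathsf{op}(x)\to M$. Resumption types $R::=\mathsf{none}\mid(\boldsymbol\alpha,x:A,B\to^{\epsilon}C)$, the latter only if $\mathit{ftv}(A)\cup\mathit{ftv}(B)\subseteq\{\boldsymbol\alpha\}$ and $\mathit{ftv}(C)\cap\{\boldsymbol\alpha\}=\emptyset$. Typing $\Gamma;R\vdash M:A\mid\epsilon$ and $\Gamma;R\vdash H:A\mid\epsilon\Rightarrow B\mid\epsilon'$ are the least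 relations with: - (Var) $\vdash\Gamma$, $x:\forall\boldsymbol\alpha.A\in\Gamma$, $\Gamma\vdash\boldsymbol B$ imply $\Gamma;R\vdash x:A[\boldsymbol B/\boldsymbol\alpha]\mid\epsilon$. - (Const) $\vdash\Gamma$ implies $\Gamma;R\vdash c:\mathit{ty}(c)\mid\epsilon$. - (Abs) $\Gamma,x:A;R\vdash M:B\mid\epsilon'$ implies $\Gamma;R\vdash\lambda x.M:A\to^{\epsilon'}B\mid\epsilon$. - (App) $\Gamma;R\vdash M_1:A\to^{\epsilon'}B\mid\epsilon$, $\Gamma;R\vdash M_2:A\mid\epsilon$, $\epsilon'\subseteq\epsilon$ imply $\Gamma;R\vdash M_1\,M_2:B\mid\epsilon$. - (Let) $\Gamma,\boldsymbol\alpha;R\vdash M_1:A\mid\epsilon$ and $\Gamma,x:\forall\boldsymbol\alpha.A;R\vdash M_2:B\mid\epsilon$ imply $\Gamma;R\vdash\mathsf{let}\ x=M_1\ \mathsf{in}\ M_2:B\mid\epsilon$. - (Weak) $\Gamma;R\vdash M:A\mid\epsilon'$, $\epsilon'\subseteq\epsilon$ imply $\Gamma;R\vdash M:A\mid\epsilon$. - (Op) $\mathit{ty}(\mathsf{op})=\forall\boldsymbol\alpha.A\hookrightarrow B$, $\mathsf{op}\in\epsilon$, $\Gamma;R\vdash M:A[\boldsymbol C/\boldsymbol\alpha]\mid\epsilon$, $\Gamma\vdash\boldsymbol C$ imply $\Gamma;R\vdash\#\mathsf{op}(M):B[\boldsymbol C/\boldsymbol\alpha]\mid\epsilon$. - (Handle)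 $\Gamma;R\vdash M:A\mid\epsilon$ and $\Gamma;R\vdash H:A\mid\epsilon\Rightarrow B\mid\epsilon'$ imply $\Gamma;R\vdash\mathsf{handle}\ M\ \mathsf{with}\ H:B\mid\epsilon'$. - (Resume) with $R=(\boldsymbol\alpha,x:A,B\to^{\epsilon}C)$: $\vdash\Gamma_1,x:D,\Gamma_2$, $\boldsymbol\alpha\in\Gamma_1$, $\epsilon\subseteq\epsilon'$, $\Gamma_1,\Gamma_2,\boldsymbol\beta,x:A[\boldsymbol\beta/\boldsymbol\alpha];R\vdash M:B[\boldsymbol\beta/\boldsymbol\alpha]\mid\epsilon'$ imply $\Gamma_1,x:D,\Gamma_2;R\vdash\mathsf{resume}\ M:C\mid\epsilon'$. - (Return clause) $\Gamma,x:A;R\vdash M:B\mid\epsilon'$, $\epsilon\subseteq\epsilon'$ imply $\Gamma;R\vdash\mathsf{return}\ x\to M:A\mid\epsilon\Rightarrow B\mid\epsilon'$. - (Operation clause) $\Gamma;R\vdash H:A\mid\epsilon\Rightarrow B\mid\epsilon'$, $\mathit{ty}(\mathsf{op})=\forall\boldsymbol\alpha.C\hookrightarrow D$, $\Gamma,\boldsymbol\alpha,x:C;(\boldsymbol\alpha,x:C,D\to^{\epsilon'}B)\vdash M:B\mid\epsilon'$ imply $\Gamma;R\vdash H;\mathsf{op}(x)\to M:A\mid\epsilon\uplus\{\mathsf{op}\}\Rightarrow B\mid\epsilon'$ ($\uplus$ = disjoint union). **Intermediate language $\lambda_{\mathrm{eff}}^{\Lambda}$.** Values $v::=c\mid\lambda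 x.e$; polymorphic values $w::=v\mid\Lambda\alpha.w$; terms $e::=x\,\boldsymbol A\mid c\mid\lambda x.e\mid e_1\,e_2\mid\mathsf{let}\ x=\Lambda\boldsymbol\alpha.e_1\ \mathsf{in}\ e_2\mid\#\mathsf{op}(\boldsymbol A,e)\mid\#\mathsf{op}(\boldsymbol\sigma,w,E)\mid\mathsf{handle}\ e\ \mathsf{with}\ h\mid\mathsf{resume}\ \boldsymbol\alpha\,x.e$ (the last binds $\boldsymbol\alpha,x$ in $e$); handlers $h::=\mathsf{return}\ x\to e\mid h;\Lambda\boldsymbol\alpha.\mathsf{op}(x)\to e$. Evaluation contexts $E^{\boldsymbol\alpha}$ are indexed by the type variables bound above the hole: $[\,]$ (empty index); $E^{\boldsymbol\alpha}\,e_2$; $v_1\,E^{\boldsymbol\alpha}$; $\#\mathsf{op}(\boldsymbol A,E^{\boldsymbol\alpha})$; $\mathsf{handle}\ E^{\boldsymbol\alpha}\ \mathsf{with}\ h$ (index $\boldsymbol\alpha$); $\mathsf{let}\ x=\Lambda\boldsymbol\beta.E^{\boldsymbol\gamma}\ \mathsf{in}\ e_2$ (index $\boldsymbol\beta,\boldsymbol\gamma$). Resumption types $r::=\mathsf{none}\mid(\boldsymbol\alpha,A,B\to^{\epsilon}C)$ with the same side conditions as for $R$. Typing $\Gamma;r\vdash e:A\mid\epsilon$, $\Gamma;r\vdash h:A\mid\epsilon\Rightarrow B\mid\epsilon'$, and $\Gamma\vdash E:\sigma\multimap A\mid\epsilon$ are the least relations with: - (Var) $\vdash\Gamma$, $x:\forall\boldsymbol\alpha.A\in\Gamma$,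 $\Gamma\vdash\boldsymbol B$ imply $\Gamma;r\vdash x\,\boldsymbol B:A[\boldsymbol B/\boldsymbol\alpha]\mid\epsilon$. - (Const), (Abs), (App), (Weak), (Handle): as in the surface language with $r,e,h$ for $R,M,H$. - (Let) $\Gamma,\boldsymbol\alpha;r\vdash e_1:A\mid\epsilon$, $\Gamma,x:\forall\boldsymbol\alpha.A;r\vdash e_2:B\mid\epsilon$ imply $\Gamma;r\vdash\mathsf{let}\ x=\Lambda\boldsymbol\alpha.e_1\ \mathsf{in}\ e_2:B\mid\epsilon$. - (Op) $\mathit{ty}(\mathsf{op})=\forall\boldsymbol\alpha.A\hookrightarrow B$, $\mathsf{op}\in\epsilon$, $\Gamma;r\vdash e:A[\boldsymbol C/\boldsymbol\alpha]\mid\epsilon$, $\Gamma\vdash\boldsymbol C$ imply $\Gamma;r\vdash\#\mathsf{op}(\boldsymbol C,e):B[\boldsymbol C/\boldsymbol\alpha]\mid\epsilon$. - (OpCont) $\mathit{ty}(\mathsf{op})=\forall\boldsymbol\alpha^I.A\hookrightarrow B$, $\mathsf{op}\in\epsilon$, $\Gamma\vdash\boldsymbol{\forall\boldsymbol\beta^J.C}^I$, $\Gamma,\boldsymbol\beta^J;r\vdash v:A[\boldsymbol C^I/\boldsymbol\alpha^I]\mid\epsilon$, $\Gamma\vdash E^{\boldsymbol\beta^J}:\forall\boldsymbol\beta^J.(B[\boldsymbol C^I/\boldsymbol\alpha^I])\multimap D\mid\epsilon$ imply $\Gamma;r\vdash\#\mathsf{op}(\boldsymbol{\forall\boldsymbol\beta^J.C}^I,\Lambda\boldsymbol\beta^J.v,E^{\boldsymbol\beta^J}):D\mid\epsilon$.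 - (Resume) with $r=(\boldsymbol\alpha,A,B\to^{\epsilon}C)$: $\boldsymbol\alpha\in\Gamma$, $\Gamma,\boldsymbol\beta,x:A[\boldsymbol\beta/\boldsymbol\alpha];r\vdash e:B[\boldsymbol\beta/\boldsymbol\alpha]\mid\epsilon'$, $\epsilon\subseteq\epsilon'$ imply $\Gamma;r\vdash\mathsf{resume}\ \boldsymbol\beta\,x.e:C\mid\epsilon'$. - (Return clause) $\Gamma,x:A;r\vdash e:B\mid\epsilon'$, $\epsilon\subseteq\epsilon'$ imply $\Gamma;r\vdash\mathsf{return}\ x\to e:A\mid\epsilon\Rightarrow B\mid\epsilon'$. - (Operation clause) $\Gamma;r\vdash h:A\mid\epsilon\Rightarrow B\mid\epsilon'$, $\mathit{ty}(\mathsf{op})=\forall\boldsymbol\alpha.C\hookrightarrow D$, $\Gamma,\boldsymbol\alpha,x:C;(\boldsymbol\alpha,C,D\to^{\epsilon'}B)\vdash e:B\mid\epsilon'$ imply $\Gamma;r\vdash h;\Lambda\boldsymbol\alpha.\mathsf{op}(x)\to e:A\mid\epsilon\uplus\{\mathsf{op}\}\Rightarrow B\mid\epsilon'$. - Contexts: $\Gamma\vdash[\,]:A\multimap A\mid\epsilon$. If $\Gamma\vdash E:\sigma\multimap(A\to^{\epsilon'}B)\mid\epsilon$, $\Gamma;\mathsf{none}\vdash e_2:A\mid\epsilon$, $\epsilon'\subseteq\epsilon$ then $\Gamma\vdash E\,e_2:\sigma\multimap B\mid\epsilon$. If $\Gamma;\mathsf{none}\vdash v_1:A\to^{\epsilon'}B\mid\epsilon$,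 $\Gamma\vdash E:\sigma\multimap A\mid\epsilon$, $\epsilon'\subseteq\epsilon$ then $\Gamma\vdash v_1\,E:\sigma\multimap B\mid\epsilon$. If $\mathit{ty}(\mathsf{op})=\forall\boldsymbol\alpha.A\hookrightarrow B$, $\mathsf{op}\in\epsilon$, $\Gamma\vdash E:\sigma\multimap A[\boldsymbol C/\boldsymbol\alpha]\mid\epsilon$, $\Gamma\vdash\boldsymbol C$ then $\Gamma\vdash\#\mathsf{op}(\boldsymbol C,E):\sigma\multimap B[\boldsymbol C/\boldsymbol\alpha]\mid\epsilon$. If $\Gamma\vdash E:\sigma\multimap A\mid\epsilon$, $\Gamma;\mathsf{none}\vdash h:A\mid\epsilon\Rightarrow B\mid\epsilon'$ then $\Gamma\vdash\mathsf{handle}\ E\ \mathsf{with}\ h:\sigma\multimap B\mid\epsilon'$. If $\Gamma,\boldsymbol\alpha\vdash E:\sigma\multimap A\mid\epsilon$, $\Gamma,x:\forall\boldsymbol\alpha.A;\mathsf{none}\vdash e:B\mid\epsilon$ then $\Gamma\vdash\mathsf{let}\ x=\Lambda\boldsymbol\alpha.E\ \mathsf{in}\ e:\forall\boldsymbol\alpha.\sigma\multimap B\mid\epsilon$. If $\Gamma\vdash E:\sigma\multimap A\mid\epsilon'$, $\epsilon'\subseteq\epsilon$ then $\Gamma\vdash E:\sigma\multimap A\mid\epsilon$. **Elaboration.** $S$ ranges over mappings from variables to variables; $\emptyset$ also denotes the identity mapping; $S\circ\{x\mapsto y\}$ is $S$ except that $x$ is mapped to $y$. The judgments $\Gamma;R\vdash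 M:A\mid\epsilon\ \triangleright^S e$ and $\Gamma;R\vdash H:A\mid\epsilon\Rightarrow B\mid\epsilon'\ \triangleright^S h$ are the least relations whose rules are those of the surface type system (same premises and side conditions), each typing premise and conclusion being decorated with an output as follows (premises use $S$ unless stated otherwise; primes/indices match subterms): - (Var) $x$ (instantiated with $\boldsymbol B$) $\triangleright^S S(x)\,\boldsymbol B$; (Const) $c\triangleright^S c$; (Weak) same output as the premise. - (Abs) if the body elaborates with $S\circ\{x\mapsto x\}$ to $e$, then $\lambda x.M\triangleright^S\lambda x.e$. - (App) $M_1\,M_2\triangleright^S e_1\,e_2$; (Op) $\#\mathsf{op}(M)$ (instantiated with $\boldsymbol C$) $\triangleright^S\#\mathsf{op}(\boldsymbol C,e)$; (Handle) $\mathsf{handle}\ M\ \mathsf{with}\ H\triangleright^S\mathsf{handle}\ e\ \mathsf{with}\ h$. - (Let) if $M_1\triangleright^S e_1$ (in context $\Gamma,\boldsymbol\alpha$) and $M_2$ elaborates with $S\circ\{x\mapsto x\}$ to $e_2$, then $\mathsf{let}\ x=M_1\ \mathsf{in}\ M_2\triangleright^S\mathsf{let}\ x=\Lambda\boldsymbol\alpha.e_1\ \mathsf{in}\ e_2$. - (Resume) if $y$ is fresh and $M$ elaborates with $S\circ\{x\mapsto y\}$ to $e$ (where $x$ is the variable in $R$ and $\boldsymbol\beta$ the type variables introduced in the premise), then $\mathsf{resume}\ M\triangleright^S\mathsf{resume}\ \boldsymbol\beta\,y.e$. - (Return clause) if $M$ elaborates with $S\circ\{x\mapsto x\}$ to $e$,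 then $\mathsf{return}\ x\to M\triangleright^S\mathsf{return}\ x\to e$. - (Operation clause) if $H\triangleright^S h$ and $M$ elaborates with $S\circ\{x\mapsto x\}$ to $e$, then $H;\mathsf{op}(x)\to M\triangleright^S h;\Lambda\boldsymbol\alpha.\mathsf{op}(x)\to e$. *)

(* Defs.v *)
From HB Require Import structures.
From mathcomp Require Import all_boot finmap.
From Stdlib Require List.

Set Implicit Arguments.
Unset Strict Implicit.
Unset Printing Implicit Defensive.

Local Open Scope fset_scope.

(** Type schemes and terms are considered up to renaming of bound variables.
    This is realised by the locally nameless representation: free (term and
    type) variables are names, bound variables are de Bruijn indices, so that
    alpha-equivalence classes are plain Coq values.  The named binders of the
    object languages ([lambda x. M], [let x = Lambda alphas. e1 in e2], ...)
    are *functions* [slam], [ilet], ... that close their body over the given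
    names; the typing and elaboration rules use them and therefore read as on
    paper. *)

Notation var := nat (only parsing).
Notation tvar := nat (only parsing).

(** ** Types and type schemes *)

Inductive pre_ty (Op : choiceType) (Base : Type) : Type :=
| TBVar (i : nat)
| TFVar (a : tvar)
| TBase (b : Base)
| TArr (A : pre_ty Op Base) (eps : {fset Op}) (B : pre_ty Op Base).
Arguments TBVar {Op Base} i.
Arguments TFVar {Op Base} a.
Arguments TBase {Op Base} b.

(** [Sch n A] is a scheme with a block of [n] quantifiers.  In the scope of a
    block binding [a_1, ..., a_n] (here and in terms), index 0 is the
    innermost variable [a_n] and index [n - 1] is [a_1]; consecutive blocks
    thus concatenate. *)
Inductive pre_scheme (Op : choiceType) (Base : Type) : Type :=
| Sch (n : nat) (A : pre_ty Op Base).

Section Types.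
Variables (Op : choiceType) (Base : Type).
Local Notation ty := (pre_ty Op Base).
Local Notation scheme := (pre_scheme Op Base).

Fixpoint ty_ftv (A : ty) : seq tvar :=
  match A with
  | TFVar a => [:: a]
  | TArr A _ B => ty_ftv A ++ ty_ftv B
  | _ => [::]
  end.

(** All indices of [A] are below [n]; [ty_lc_at 0 A] says that the raw
    expression [A] denotes a type. *)
Fixpoint ty_lc_at (n : nat) (A : ty) : bool :=
  match A with
  | TBVar i => i < n
  | TArr A _ B => ty_lc_at n A && ty_lc_at n B
  | _ => true
  end.
Definition ty_lc (A : ty) : bool := ty_lc_at 0 A.

(** Binds the names [als], as a block of binders found [k] levels up. *)
Fixpoint ty_close (als : seq tvar) (k : nat) (A : ty) : ty :=
  match A with
  | TFVar a => if a \in als then TBVar (k + index a (rev als)) else TFVar a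
  | TArr A eps B => TArr (ty_close als k A) eps (ty_close als k B)
  | _ => A
  end.

(** Instantiates the block of variables bound in a scheme body, i.e.
    [A[Bs/alphas]] for the body [A] of [forall alphas. A]. *)
Fixpoint ty_open (Bs : seq ty) (A : ty) : ty :=
  match A with
  | TBVar i => nth (TBVar i) (rev Bs) i
  | TArr A eps B => TArr (ty_open Bs A) eps (ty_open Bs B)
  | _ => A
  end.

(** Simultaneous substitution [A[Bs/als]] for free type variables. *)
Fixpoint ty_subst (als : seq tvar) (Bs : seq ty) (A : ty) : ty :=
  match A with
  | TFVar a => if a \in als then nth (TFVar a) Bs (index a als) else TFVar a
  | TArr A eps B => TArr (ty_subst als Bs A) eps (ty_subst als Bs B)
  | _ => A
  end.

Definition sch_ftv (s : scheme) : seq tvar := let: Sch _ A := s in ty_ftv A.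
Definition sch_lc (s : scheme) : bool := let: Sch n A := s in ty_lc_at n A.
Definition sch_close (als : seq tvar) (k : nat) (s : scheme) : scheme :=
  let: Sch n A := s in Sch n (ty_close als (k + n) A).

Definition smono (A : ty) : scheme := Sch 0 A.

(** [forall als. s] *)
Definition sall (als : seq tvar) (s : scheme) : scheme :=
  let: Sch n A := s in Sch (size als + n) (ty_close als n A).

Lemma ty_open_close (als : seq tvar) (Bs : seq ty) (A : ty) :
  uniq als -> size Bs = size als -> ty_lc A ->
  ty_open Bs (ty_close als 0 A) = ty_subst als Bs A.
Proof.
move=> Hu Hs; rewrite /ty_lc; elim: A => [i|a|b|A IHA eps B IHB] //=.
- move=> _; case: ifP => //= Ha; rewrite add0n.
  have Hi : index a als < size als by rewrite index_mem.
  have Hi' : index a (rev als) < size Bs.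
    by rewrite Hs -(size_rev als) index_mem mem_rev.
  rewrite nth_rev // Hs.
  have -> : size als - (index a (rev als)).+1 = index a als.
    apply/eqP; rewrite -(nth_uniq a _ _ Hu) ?nth_index //; last first.
      by rewrite ltn_subrL /=; case: (als) Hi.
    by rewrite -nth_rev -?Hs // nth_index // mem_rev.
  by apply: set_nth_default; rewrite Hs.
- by case/andP=> HA HB; rewrite IHA // IHB.
Qed.

(** The signature [forall alphas. A ~> B] of an operation; the side condition
    [ftv A U ftv B <= alphas] makes it closed. *)
Record op_sig : Type := OpSig {
  os_arity : nat;
  os_dom : ty;
  os_cod : ty;
  os_dom_closed : ty_lc_at os_arity os_dom && nilp (ty_ftv os_dom);
  os_cod_closed : ty_lc_at os_arity os_cod && nilp (ty_ftv os_cod) }.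

End Types.

(** The parameters of both languages.  [ty_const c = (is, i)] stands for the
    closed first-order type [i_1 -> ... -> i_(n-1) -> i]. *)
Record signature : Type := Signature {
  op : choiceType;
  base : Type;
  base_bot : base;
  const : Type;
  ty_const : const -> seq base * base;
  ty_op : op -> op_sig op base }.

Definition ty (Sg : signature) : Type := pre_ty (op Sg) (base Sg).
Definition scheme (Sg : signature) : Type := pre_scheme (op Sg) (base Sg).
Definition effect (Sg : signature) : Type := {fset op Sg}.

Definition const_type (Sg : signature) (c : const Sg) : ty Sg :=
  foldr (fun i A => TArr (TBase i) fset0 A)
    (TBase (ty_const c).2) (ty_const c).1.

(** For [ty(op) = forall alphas. A ~> B], [op_dom_at o Cs] is [A[Cs/alphas]]
    and [op_cod_at o Cs] is [B[Cs/alphas]]. *)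
Definition op_arity (Sg : signature) (o : op Sg) : nat := os_arity (ty_op o).
Definition op_dom_at (Sg : signature) (o : op Sg) (Cs : seq (ty Sg)) : ty Sg :=
  ty_open Cs (os_dom (ty_op o)).
Definition op_cod_at (Sg : signature) (o : op Sg) (Cs : seq (ty Sg)) : ty Sg :=
  ty_open Cs (os_cod (ty_op o)).

Definition tvars (Sg : signature) (als : seq tvar) : seq (ty Sg) :=
  [seq TFVar a | a <- als].
Arguments tvars {Sg} als.

(** ** Typing contexts (extended on the right) *)

Inductive decl (Sg : signature) : Type :=
| DVar (x : var) (s : scheme Sg)
| DTVar (a : tvar).
Arguments DTVar {Sg} a.

Definition ctx (Sg : signature) : Type := seq (decl Sg).

Definition vdom (Sg : signature) (G : ctx Sg) : seq var :=
  pmap (fun d => if d is DVar x _ then Some x else None) G.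
Definition tdom (Sg : signature) (G : ctx Sg) : seq tvar :=
  pmap (fun d => if d is DTVar a then Some a else None) G.

Definition add_var (Sg : signature) (G : ctx Sg) (x : var) (s : scheme Sg) :
  ctx Sg := rcons G (DVar x s).
Definition add_tvars (Sg : signature) (G : ctx Sg) (als : seq tvar) : ctx Sg :=
  G ++ [seq DTVar a | a <- als].

Definition wf_sch (Sg : signature) (G : ctx Sg) (s : scheme Sg) : Prop :=
  sch_lc s /\ {subset sch_ftv s <= tdom G}.

Definition wf_tys (Sg : signature) (G : ctx Sg) (As : seq (ty Sg)) : Prop :=
  forall A, List.In A As -> wf_sch G (smono A).

Inductive wf_ctx (Sg : signature) : ctx Sg -> Prop :=
| wf_nil : wf_ctx [::]
| wf_var G x s :
    wf_ctx G -> x \notin vdom G -> wf_sch G s -> wf_ctx (rcons G (DVar x s))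
| wf_tvar G a :
    wf_ctx G -> a \notin tdom G -> wf_ctx (rcons G (DTVar a)).

(** ** Surface language *)

Inductive name : Type :=
| BV (i : nat)
| FV (x : var).

Definition name_close (x : var) (k : nat) (n : name) : name :=
  match n with
  | FV y => if y == x then BV k else FV y
  | BV i => BV i
  end.

(** [SLam], the second argument of [SLet], [SRet] and the body of [SOpCl]
    bind one term variable. *)
Inductive stm (Sg : signature) : Type :=
| SVar (n : name)
| SConst (c : const Sg)
| SLam (M : stm Sg)
| SApp (M1 M2 : stm Sg)
| SLet (M1 M2 : stm Sg)
| SOp (o : op Sg) (M : stm Sg)
| SHandle (M : stm Sg) (H : shdl Sg)
| SResume (M : stm Sg)
with shdl (Sg : signature) : Type :=
| SRet (M : stm Sg)
| SOpCl (H : shdl Sg) (o : op Sg) (M : stm Sg).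
Arguments SVar {Sg} n.

Fixpoint sclose (Sg : signature) (x : var) (k : nat) (M : stm Sg) : stm Sg :=
  match M with
  | SVar n => SVar (name_close x k n)
  | SConst c => SConst c
  | SLam M => SLam (sclose x k.+1 M)
  | SApp M1 M2 => SApp (sclose x k M1) (sclose x k M2)
  | SLet M1 M2 => SLet (sclose x k M1) (sclose x k.+1 M2)
  | SOp o M => SOp o (sclose x k M)
  | SHandle M H => SHandle (sclose x k M) (sclose_hdl x k H)
  | SResume M => SResume (sclose x k M)
  end
with sclose_hdl (Sg : signature) (x : var) (k : nat) (H : shdl Sg) : shdl Sg :=
  match H with
  | SRet M => SRet (sclose x k.+1 M)
  | SOpCl H o M => SOpCl (sclose_hdl x k H) o (sclose x k.+1 M)
  end.

Definition slam (Sg : signature) (x : var) (M : stm Sg) : stm Sg :=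
  SLam (sclose x 0 M).
Definition slet (Sg : signature) (x : var) (M1 M2 : stm Sg) : stm Sg :=
  SLet M1 (sclose x 0 M2).
Definition sret (Sg : signature) (x : var) (M : stm Sg) : shdl Sg :=
  SRet (sclose x 0 M).
Definition sopcl (Sg : signature) (H : shdl Sg) (o : op Sg) (x : var)
  (M : stm Sg) : shdl Sg := SOpCl H o (sclose x 0 M).

(** Resumption types; [RSome als x A B eps C] is [(als, x:A, B ->^eps C)],
    whose variables are names declared in the ambient context. *)
Inductive srt (Sg : signature) : Type :=
| RNone
| RSome (als : seq tvar) (x : var) (A B : ty Sg) (eps : effect Sg) (C : ty Sg).
Arguments RNone {Sg}.

Definition wf_res (Sg : signature) (als : seq tvar) (A B C : ty Sg) : Prop :=
  [/\ [&& ty_lc A, ty_lc B & ty_lc C],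
      {subset ty_ftv A ++ ty_ftv B <= als} &
      {in als, forall a, a \notin ty_ftv C}].

(** The well-formedness of resumption types is required where they are
    introduced, i.e. in the rule for operation clauses. *)
Inductive styp (Sg : signature) :
  ctx Sg -> srt Sg -> stm Sg -> ty Sg -> effect Sg -> Prop :=
| ST_Var G R x n A Bs eps :
    wf_ctx G ->
    List.In (DVar x (Sch n A)) G ->
    size Bs = n ->
    wf_tys G Bs ->
    styp G R (SVar (FV x)) (ty_open Bs A) eps
| ST_Const G R c eps :
    wf_ctx G ->
    styp G R (SConst c) (const_type c) eps
| ST_Abs G R x M A B eps' eps :
    styp (add_var G x (smono A)) R M B eps' ->
    styp G R (slam x M) (TArr A eps' B) eps
| ST_App G R M1 M2 A B eps' eps :
    styp G R M1 (TArr A eps' B) eps ->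
    styp G R M2 A eps ->
    eps' `<=` eps ->
    styp G R (SApp M1 M2) B eps
| ST_Let G R als x M1 M2 A B eps :
    styp (add_tvars G als) R M1 A eps ->
    styp (add_var G x (sall als (smono A))) R M2 B eps ->
    styp G R (slet x M1 M2) B eps
| ST_Weak G R M A eps' eps :
    styp G R M A eps' ->
    eps' `<=` eps ->
    styp G R M A eps
| ST_Op G R o Cs M eps :
    size Cs = op_arity o ->
    o \in eps ->
    styp G R M (op_dom_at o Cs) eps ->
    wf_tys G Cs ->
    styp G R (SOp o M) (op_cod_at o Cs) eps
| ST_Handle G R M H A B eps eps' :
    styp G R M A eps ->
    shtyp G R H A eps B eps' ->
    styp G R (SHandle M H) B eps'
| ST_Resume G1 G2 als bes x A B eps C D M eps' :
    wf_ctx (add_var G1 x (smono D) ++ G2) ->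
    {subset als <= tdom G1} ->
    eps `<=` eps' ->
    size bes = size als ->
    styp (add_var (add_tvars (G1 ++ G2) bes) x
            (smono (ty_subst als (tvars bes) A)))
         (RSome als x A B eps C) M (ty_subst als (tvars bes) B) eps' ->
    styp (add_var G1 x (smono D) ++ G2) (RSome als x A B eps C)
         (SResume M) C eps'
with shtyp (Sg : signature) :
  ctx Sg -> srt Sg -> shdl Sg -> ty Sg -> effect Sg -> ty Sg -> effect Sg ->
  Prop :=
| ST_Ret G R x M A eps B eps' :
    styp (add_var G x (smono A)) R M B eps' ->
    eps `<=` eps' ->
    shtyp G R (sret x M) A eps B eps'
| ST_OpCl G R H o als x M A eps B eps' C D :
    shtyp G R H A eps B eps' ->
    size als = op_arity o ->
    C = op_dom_at o (tvars als) ->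
    D = op_cod_at o (tvars als) ->
    wf_res als C D B ->
    styp (add_var (add_tvars G als) x (smono C)) (RSome als x C D eps' B)
         M B eps' ->
    o \notin eps ->
    shtyp G R (sopcl H o x M) A (eps `|` [fset o]) B eps'.

(** ** Intermediate language

    [VLam], the last arguments of [ILet] and [ELet], and [IRet] bind one term
    variable; [PVal n], the first term of [ILet n] and the context of [ELet n]
    are under [n] type binders; [IResume n] and [IOpCl n] bind [n] type
    variables and one term variable. *)

Inductive itm (Sg : signature) : Type :=
| IVar (x : name) (As : seq (ty Sg))
| IVal (v : ival Sg)
| IApp (e1 e2 : itm Sg)
| ILet (n : nat) (e1 e2 : itm Sg)
| IOp (o : op Sg) (As : seq (ty Sg)) (e : itm Sg)
| IOpCont (o : op Sg) (ss : seq (scheme Sg)) (w : ipval Sg) (E : ectx Sg)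
| IHandle (e : itm Sg) (h : ihdl Sg)
| IResume (n : nat) (e : itm Sg)
with ival (Sg : signature) : Type :=
| VConst (c : const Sg)
| VLam (e : itm Sg)
with ipval (Sg : signature) : Type :=
| PVal (n : nat) (v : ival Sg)
with ihdl (Sg : signature) : Type :=
| IRet (e : itm Sg)
| IOpCl (h : ihdl Sg) (n : nat) (o : op Sg) (e : itm Sg)
with ectx (Sg : signature) : Type :=
| EHole
| EAppL (E : ectx Sg) (e2 : itm Sg)
| EAppR (v1 : ival Sg) (E : ectx Sg)
| EOp (o : op Sg) (As : seq (ty Sg)) (E : ectx Sg)
| EHandle (E : ectx Sg) (h : ihdl Sg)
| ELet (n : nat) (E : ectx Sg) (e2 : itm Sg).
Arguments IVar {Sg} x As.
Arguments EHole {Sg}.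

(** Generic traversal: [f k] is applied to the variables under [k] term
    binders, [g j] to the types under [j] type binders. *)
Section Traversal.
Variables (Sg : signature).
Variables (f : nat -> name -> name) (g : nat -> ty Sg -> ty Sg).

Definition map_scheme (j : nat) (s : scheme Sg) : scheme Sg :=
  let: Sch n A := s in Sch n (g (j + n) A).

Fixpoint imap (k j : nat) (e : itm Sg) : itm Sg :=
  match e with
  | IVar x As => IVar (f k x) [seq g j A | A <- As]
  | IVal v => IVal (imap_val k j v)
  | IApp e1 e2 => IApp (imap k j e1) (imap k j e2)
  | ILet n e1 e2 => ILet n (imap k (j + n) e1) (imap k.+1 j e2)
  | IOp o As e => IOp o [seq g j A | A <- As] (imap k j e)
  | IOpCont o ss w E =>
      IOpCont o [seq map_scheme j s | s <- ss] (imap_pval k j w)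
        (imap_ectx k j E)
  | IHandle e h => IHandle (imap k j e) (imap_hdl k j h)
  | IResume n e => IResume n (imap k.+1 (j + n) e)
  end
with imap_val (k j : nat) (v : ival Sg) : ival Sg :=
  match v with
  | VConst c => VConst c
  | VLam e => VLam (imap k.+1 j e)
  end
with imap_pval (k j : nat) (w : ipval Sg) : ipval Sg :=
  match w with
  | PVal n v => PVal n (imap_val k (j + n) v)
  end
with imap_hdl (k j : nat) (h : ihdl Sg) : ihdl Sg :=
  match h with
  | IRet e => IRet (imap k.+1 j e)
  | IOpCl h n o e => IOpCl (imap_hdl k j h) n o (imap k.+1 (j + n) e)
  end
with imap_ectx (k j : nat) (E : ectx Sg) : ectx Sg :=
  match E with
  | EHole => EHole
  | EAppL E e2 => EAppL (imap_ectx k j E) (imap k j e2)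
  | EAppR v1 E => EAppR (imap_val k j v1) (imap_ectx k j E)
  | EOp o As E => EOp o [seq g j A | A <- As] (imap_ectx k j E)
  | EHandle E h => EHandle (imap_ectx k j E) (imap_hdl k j h)
  | ELet n E e2 => ELet n (imap_ectx k (j + n) E) (imap k.+1 j e2)
  end.

End Traversal.

Definition iclose (Sg : signature) (x : var) (e : itm Sg) : itm Sg :=
  imap (name_close x) (fun _ A => A) 0 0 e.
Definition iclose_ty (Sg : signature) (als : seq tvar) (e : itm Sg) : itm Sg :=
  imap (fun _ n => n) (@ty_close _ _ als) 0 0 e.
Definition vclose_ty (Sg : signature) (als : seq tvar) (v : ival Sg) : ival Sg :=
  imap_val (fun _ n => n) (@ty_close _ _ als) 0 0 v.
Definition eclose_ty (Sg : signature) (als : seq tvar) (E : ectx Sg) : ectx Sg :=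
  imap_ectx (fun _ n => n) (@ty_close _ _ als) 0 0 E.

Definition vlam (Sg : signature) (x : var) (e : itm Sg) : ival Sg :=
  VLam (iclose x e).
Definition plam (Sg : signature) (als : seq tvar) (v : ival Sg) : ipval Sg :=
  PVal (size als) (vclose_ty als v).
Definition ilet (Sg : signature) (x : var) (als : seq tvar) (e1 e2 : itm Sg) :
  itm Sg := ILet (size als) (iclose_ty als e1) (iclose x e2).
Definition iresume (Sg : signature) (als : seq tvar) (x : var) (e : itm Sg) :
  itm Sg := IResume (size als) (iclose x (iclose_ty als e)).
Definition iret (Sg : signature) (x : var) (e : itm Sg) : ihdl Sg :=
  IRet (iclose x e).
Definition iopcl (Sg : signature) (h : ihdl Sg) (als : seq tvar) (o : op Sg)
  (x : var) (e : itm Sg) : ihdl Sg :=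
  IOpCl h (size als) o (iclose x (iclose_ty als e)).
Definition elet (Sg : signature) (x : var) (als : seq tvar) (E : ectx Sg)
  (e2 : itm Sg) : ectx Sg := ELet (size als) (eclose_ty als E) (iclose x e2).

Inductive irt (Sg : signature) : Type :=
| IRNone
| IRSome (als : seq tvar) (A B : ty Sg) (eps : effect Sg) (C : ty Sg).
Arguments IRNone {Sg}.

(** In [IT_OpCont] the typing of [E] forces its index, i.e. the number of type
    variables bound above the hole, to be that of [bes].  The premises
    [ty_lc] of [IT_OpCont] and [ET_Hole] only exclude raw expressions that do
    not denote types. *)
Inductive ityp (Sg : signature) :
  ctx Sg -> irt Sg -> itm Sg -> ty Sg -> effect Sg -> Prop :=
| IT_Var G r x n A Bs eps :
    wf_ctx G ->
    List.In (DVar x (Sch n A)) G ->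
    size Bs = n ->
    wf_tys G Bs ->
    ityp G r (IVar (FV x) Bs) (ty_open Bs A) eps
| IT_Const G r c eps :
    wf_ctx G ->
    ityp G r (IVal (VConst c)) (const_type c) eps
| IT_Abs G r x e A B eps' eps :
    ityp (add_var G x (smono A)) r e B eps' ->
    ityp G r (IVal (vlam x e)) (TArr A eps' B) eps
| IT_App G r e1 e2 A B eps' eps :
    ityp G r e1 (TArr A eps' B) eps ->
    ityp G r e2 A eps ->
    eps' `<=` eps ->
    ityp G r (IApp e1 e2) B eps
| IT_Let G r als x e1 e2 A B eps :
    ityp (add_tvars G als) r e1 A eps ->
    ityp (add_var G x (sall als (smono A))) r e2 B eps ->
    ityp G r (ilet x als e1 e2) B eps
| IT_Weak G r e A eps' eps :
    ityp G r e A eps' ->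
    eps' `<=` eps ->
    ityp G r e A eps
| IT_Op G r o Cs e eps :
    size Cs = op_arity o ->
    o \in eps ->
    ityp G r e (op_dom_at o Cs) eps ->
    wf_tys G Cs ->
    ityp G r (IOp o Cs e) (op_cod_at o Cs) eps
| IT_OpCont G r o bes Cs v E D eps :
    size Cs = op_arity o ->
    o \in eps ->
    (forall C, List.In C Cs -> ty_lc C /\ wf_sch G (sall bes (smono C))) ->
    ityp (add_tvars G bes) r (IVal v) (op_dom_at o Cs) eps ->
    etyp G E (sall bes (smono (op_cod_at o Cs))) D eps ->
    ityp G r (IOpCont o [seq sall bes (smono C) | C <- Cs] (plam bes v) E) D eps
| IT_Handle G r e h A B eps eps' :
    ityp G r e A eps ->
    ihtyp G r h A eps B eps' ->
    ityp G r (IHandle e h) B eps'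
| IT_Resume G als bes y A B eps C e eps' :
    {subset als <= tdom G} ->
    size bes = size als ->
    ityp (add_var (add_tvars G bes) y (smono (ty_subst als (tvars bes) A)))
         (IRSome als A B eps C) e (ty_subst als (tvars bes) B) eps' ->
    eps `<=` eps' ->
    ityp G (IRSome als A B eps C) (iresume bes y e) C eps'
with ihtyp (Sg : signature) :
  ctx Sg -> irt Sg -> ihdl Sg -> ty Sg -> effect Sg -> ty Sg -> effect Sg ->
  Prop :=
| IT_Ret G r x e A eps B eps' :
    ityp (add_var G x (smono A)) r e B eps' ->
    eps `<=` eps' ->
    ihtyp G r (iret x e) A eps B eps'
| IT_OpCl G r h o als x e A eps B eps' C D :
    ihtyp G r h A eps B eps' ->
    size als = op_arity o ->
    C = op_dom_at o (tvars als) ->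
    D = op_cod_at o (tvars als) ->
    wf_res als C D B ->
    ityp (add_var (add_tvars G als) x (smono C)) (IRSome als C D eps' B)
         e B eps' ->
    o \notin eps ->
    ihtyp G r (iopcl h als o x e) A (eps `|` [fset o]) B eps'
with etyp (Sg : signature) :
  ctx Sg -> ectx Sg -> scheme Sg -> ty Sg -> effect Sg -> Prop :=
| ET_Hole G A eps :
    ty_lc A ->
    etyp G EHole (smono A) A eps
| ET_AppL G E e2 s A B eps' eps :
    etyp G E s (TArr A eps' B) eps ->
    ityp G IRNone e2 A eps ->
    eps' `<=` eps ->
    etyp G (EAppL E e2) s B eps
| ET_AppR G v1 E s A B eps' eps :
    ityp G IRNone (IVal v1) (TArr A eps' B) eps ->
    etyp G E s A eps ->
    eps' `<=` eps ->
    etyp G (EAppR v1 E) s B eps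
| ET_Op G o Cs E s eps :
    size Cs = op_arity o ->
    o \in eps ->
    etyp G E s (op_dom_at o Cs) eps ->
    wf_tys G Cs ->
    etyp G (EOp o Cs E) s (op_cod_at o Cs) eps
| ET_Handle G E h s A B eps eps' :
    etyp G E s A eps ->
    ihtyp G IRNone h A eps B eps' ->
    etyp G (EHandle E h) s B eps'
| ET_Let G als x E e s A B eps :
    etyp (add_tvars G als) E s A eps ->
    ityp (add_var G x (sall als (smono A))) IRNone e B eps ->
    etyp G (elet x als E e) (sall als s) B eps
| ET_Weak G E s A eps' eps :
    etyp G E s A eps' ->
    eps' `<=` eps ->
    etyp G E s A eps.

(** ** Elaboration *)

Definition upd (S : var -> var) (x y : var) : var -> var :=
  fun z => if z == x then y else S z.

(** A variable bound in the output must differ from the images of the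
    variables in scope, for it would capture them otherwise.  As bound
    variables can be renamed, this is the usual variable convention; it is
    what the freshness of [y] in the rule for [resume] amounts to, and it has
    to be imposed on the other binders as well. *)
Definition avoids (Sg : signature) (S : var -> var) (G : ctx Sg) (x : var) :
  Prop := forall z, z \in vdom G -> S z <> x.

Inductive elab (Sg : signature) :
  ctx Sg -> srt Sg -> stm Sg -> ty Sg -> effect Sg -> (var -> var) -> itm Sg ->
  Prop :=
| EL_Var G R x n A Bs eps S :
    wf_ctx G ->
    List.In (DVar x (Sch n A)) G ->
    size Bs = n ->
    wf_tys G Bs ->
    elab G R (SVar (FV x)) (ty_open Bs A) eps S (IVar (FV (S x)) Bs)
| EL_Const G R c eps S :
    wf_ctx G ->
    elab G R (SConst c) (const_type c) eps S (IVal (VConst c))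
| EL_Abs G R x M A B eps' eps S e :
    avoids S G x ->
    elab (add_var G x (smono A)) R M B eps' (upd S x x) e ->
    elab G R (slam x M) (TArr A eps' B) eps S (IVal (vlam x e))
| EL_App G R M1 M2 A B eps' eps S e1 e2 :
    elab G R M1 (TArr A eps' B) eps S e1 ->
    elab G R M2 A eps S e2 ->
    eps' `<=` eps ->
    elab G R (SApp M1 M2) B eps S (IApp e1 e2)
| EL_Let G R als x M1 M2 A B eps S e1 e2 :
    avoids S G x ->
    elab (add_tvars G als) R M1 A eps S e1 ->
    elab (add_var G x (sall als (smono A))) R M2 B eps (upd S x x) e2 ->
    elab G R (slet x M1 M2) B eps S (ilet x als e1 e2)
| EL_Weak G R M A eps' eps S e :
    elab G R M A eps' S e ->
    eps' `<=` eps ->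
    elab G R M A eps S e
| EL_Op G R o Cs M eps S e :
    size Cs = op_arity o ->
    o \in eps ->
    elab G R M (op_dom_at o Cs) eps S e ->
    wf_tys G Cs ->
    elab G R (SOp o M) (op_cod_at o Cs) eps S (IOp o Cs e)
| EL_Handle G R M H A B eps eps' S e h :
    elab G R M A eps S e ->
    helab G R H A eps B eps' S h ->
    elab G R (SHandle M H) B eps' S (IHandle e h)
| EL_Resume G1 G2 als bes x y A B eps C D M eps' S e :
    wf_ctx (add_var G1 x (smono D) ++ G2) ->
    {subset als <= tdom G1} ->
    eps `<=` eps' ->
    size bes = size als ->
    y \notin vdom (add_var G1 x (smono D) ++ G2) ->
    avoids S (add_var G1 x (smono D) ++ G2) y ->
    elab (add_var (add_tvars (G1 ++ G2) bes) x
            (smono (ty_subst als (tvars bes) A)))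
         (RSome als x A B eps C) M (ty_subst als (tvars bes) B) eps'
         (upd S x y) e ->
    elab (add_var G1 x (smono D) ++ G2) (RSome als x A B eps C)
         (SResume M) C eps' S (iresume bes y e)
with helab (Sg : signature) :
  ctx Sg -> srt Sg -> shdl Sg -> ty Sg -> effect Sg -> ty Sg -> effect Sg ->
  (var -> var) -> ihdl Sg -> Prop :=
| EL_Ret G R x M A eps B eps' S e :
    avoids S G x ->
    elab (add_var G x (smono A)) R M B eps' (upd S x x) e ->
    eps `<=` eps' ->
    helab G R (sret x M) A eps B eps' S (iret x e)
| EL_OpCl G R H o als x M A eps B eps' C D S h e :
    avoids S G x ->
    helab G R H A eps B eps' S h ->
    size als = op_arity o ->
    C = op_dom_at o (tvars als) ->
    D = op_cod_at o (tvars als) ->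
    wf_res als C D B ->
    elab (add_var (add_tvars G als) x (smono C)) (RSome als x C D eps' B)
         M B eps' (upd S x x) e ->
    o \notin eps ->
    helab G R (sopcl H o x M) A (eps `|` [fset o]) B eps' S
          (iopcl h als o x e).

(* Main.v *)
(** The target context of an elaboration declares the same type variables as
    the source context [G], and for every [x : s] in [G] it declares
    [S x : s].  It may contain more term variables: the rule for [resume]
    removes a variable from the source context, but none from the target
    context.  These extra variables are all chosen beyond a bound [N] on the
    names bound in the (finite) source derivation, so that the names bound
    there remain fresh in the target context and are not captured. *)

Require Import Defs.
From mathcomp Require Import all_boot finmap.

Set Implicit Arguments.
Unset Strict Implicit.
Unset Printing Implicit Defensive.

Local Open Scope fset_scope.

Scheme styp_mut := Minimality for styp Sort Prop
  with shtyp_mut := Minimality for shtyp Sort Prop.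
Combined Scheme styp_shtyp_ind from styp_mut, shtyp_mut.

(** * Domains and well-formedness of typing contexts *)

Section Contexts.
Variable Sg : signature.
Implicit Types (G : ctx Sg) (s : scheme Sg) (x : nat) (als : seq nat).

Lemma vdom_cat G1 G2 : vdom (G1 ++ G2) = vdom G1 ++ vdom G2.
Proof. exact: pmap_cat. Qed.

Lemma tdom_cat G1 G2 : tdom (G1 ++ G2) = tdom G1 ++ tdom G2.
Proof. exact: pmap_cat. Qed.

Lemma vdom_add_var G x s : vdom (add_var G x s) = rcons (vdom G) x.
Proof. by rewrite /add_var -!cats1 vdom_cat. Qed.

Lemma tdom_add_var G x s : tdom (add_var G x s) = tdom G.
Proof. by rewrite /add_var -cats1 tdom_cat cats0. Qed.

Lemma vdom_add_tvars G als : vdom (add_tvars G als) = vdom G.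
Proof.
rewrite /add_tvars vdom_cat -[RHS]cats0; congr (_ ++ _).
by elim: als.
Qed.

Lemma tdom_add_tvars G als : tdom (add_tvars G als) = tdom G ++ als.
Proof.
rewrite /add_tvars tdom_cat; congr (_ ++ _).
by elim: als => //= a als ->.
Qed.

Lemma In_vdom G x s : List.In (DVar x s) G -> x \in vdom G.
Proof.
elim: G => //= d G IH [->|/IH Hx] /=; first by rewrite mem_head.
by case: d => [y t|a] //=; rewrite in_cons Hx orbT.
Qed.

Lemma vdom_In G x : x \in vdom G -> exists s, List.In (DVar x s) G.
Proof.
elim: G => //= -[y t|a] G IH /=; last by case/IH => s Hs; exists s; right.
rewrite in_cons => /orP[/eqP ->|/IH[s Hs]]; first by exists t; left.
by exists s; right.
Qed.

Lemma wf_rcons_inv G d : wf_ctx (rcons G d) ->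
  wf_ctx G /\ match d with
             | DVar x s => x \notin vdom G /\ wf_sch G s
             | DTVar a => a \notin tdom G
             end.
Proof.
move E: (rcons G d) => G1 H; case: H E => [|G0 y t|G0 a].
- by case: (G).
- by move=> ? ? ? /rcons_inj[-> ->].
- by move=> ? ? /rcons_inj[-> ->].
Qed.

Lemma wf_add_var_inv G x s :
  wf_ctx (add_var G x s) -> [/\ wf_ctx G, x \notin vdom G & wf_sch G s].
Proof. by case/wf_rcons_inv=> ? []. Qed.

Lemma wf_sch_tdom G G' s : tdom G' = tdom G -> wf_sch G s -> wf_sch G' s.
Proof. by rewrite /wf_sch => ->. Qed.

Lemma wf_tys_tdom G G' As : tdom G' = tdom G -> wf_tys G As -> wf_tys G' As.
Proof. by move=> E H A /H; apply: wf_sch_tdom. Qed.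

Lemma add_tvars_rcons G als a :
  add_tvars G (rcons als a) = rcons (add_tvars G als) (DTVar a).
Proof. by rewrite /add_tvars map_rcons rcons_cat. Qed.

(** Freshness of added type variables depends on [tdom] alone, so it transfers to a target context
    with other term variables. *)
Lemma wf_add_tvars_tdom G G' als : tdom G' = tdom G ->
  wf_ctx G' -> wf_ctx (add_tvars G als) -> wf_ctx (add_tvars G' als).
Proof.
move=> E wG'; elim/last_ind: als => [|als a IH].
  by rewrite /add_tvars !cats0.
rewrite !add_tvars_rcons => /wf_rcons_inv[/IH wa].
by rewrite tdom_add_tvars -E -tdom_add_tvars; apply: wf_tvar.
Qed.

Lemma wf_add_tvars_inv G als : wf_ctx (add_tvars G als) -> wf_ctx G.
Proof.
elim/last_ind: als => [|als a IH]; first by rewrite /add_tvars !cats0.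
by rewrite add_tvars_rcons => /wf_rcons_inv[/IH].
Qed.

(** Every rule either demands a well-formed context or has a premise in the same or an extended
    context. Applied to a premise under a binder, this makes the bound name fresh for the source
    context. *)
Lemma styp_shtyp_wf_ctx :
  (forall G R (M : stm Sg) A eps, styp G R M A eps -> wf_ctx G) /\
  (forall G R (H : shdl Sg) A eps B eps',
     shtyp G R H A eps B eps' -> wf_ctx G).
Proof.
apply: styp_shtyp_ind => //.
- by move=> G R x M A B eps' eps _ /wf_add_var_inv[].
- by move=> G R als x M1 M2 A B eps _ /wf_add_tvars_inv.
- by move=> G R x M A eps B eps' _ /wf_add_var_inv[].
Qed.

Lemma styp_wf_ctx G R (M : stm Sg) A eps : styp G R M A eps -> wf_ctx G.
Proof. exact: (proj1 styp_shtyp_wf_ctx). Qed.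

(** * Renamings from source to target contexts *)

Definition ctx_renaming (N : nat) (S : nat -> nat) G G' : Prop :=
  [/\ wf_ctx G', tdom G' = tdom G,
      forall x s, List.In (DVar x s) G -> List.In (DVar (S x) s) G' &
      forall x, x \in vdom G' -> (x \in vdom G) || (N <= x)].

(** Allows the bounds obtained from several premises to be merged into their maximum. *)
Lemma ctx_renaming_le N N' S G G' :
  N <= N' -> ctx_renaming N' S G G' -> ctx_renaming N S G G'.
Proof.
move=> le [wG' Et HS HN]; split=> // x /HN /orP[-> // | le'].
by rewrite (leq_trans le le') orbT.
Qed.

Lemma ctx_renaming_mem N S G G' x :
  ctx_renaming N S G G' -> x \in vdom G -> S x \in vdom G'.
Proof. by case=> _ _ HS _ /vdom_In[s /HS /In_vdom]. Qed.

Lemma ctx_renaming_avoids N S G G' x :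
  ctx_renaming N S G G' -> x \notin vdom G' -> avoids S G x.
Proof. by move=> HS Hx z /(ctx_renaming_mem HS) + E; rewrite E (negPf Hx). Qed.

Lemma ctx_renaming_fresh N S G G' x :
  ctx_renaming N S G G' -> x < N -> x \notin vdom G -> x \notin vdom G'.
Proof.
by case=> _ _ _ HN xN xG; apply/negP=> /HN; rewrite (negPf xG) leqNgt xN.
Qed.

Lemma ctx_renaming_add_tvars N S G G' als :
  wf_ctx (add_tvars G als) -> ctx_renaming N S G G' ->
  ctx_renaming N S (add_tvars G als) (add_tvars G' als).
Proof.
move=> wG [wG' Et HS HN]; split.
- exact: (wf_add_tvars_tdom Et).
- by rewrite !tdom_add_tvars Et.
- move=> x s; rewrite /add_tvars => /List.in_app_iff[/HS|] H.
    by apply/List.in_app_iff; left.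
  by exfalso; elim: als H {wG} => //= a als IH [|].
- by move=> x; rewrite !vdom_add_tvars; apply: HN.
Qed.

(* [y = x] at the ordinary binders; [y] is fresh at [resume], where [G] is the
   source context from which the old [x] has been removed while it is still
   present in the context [G0] of the conclusion. *)
Lemma ctx_renaming_add_var N S G0 G G' x y s :
  tdom G = tdom G0 ->
  (forall z t, List.In (DVar z t) G -> List.In (DVar z t) G0) ->
  {subset vdom G0 <= x :: vdom G} ->
  (y == x) || (N <= y) -> y \notin vdom G' ->
  wf_ctx (add_var G x s) -> ctx_renaming N S G0 G' ->
  ctx_renaming N (upd S x y) (add_var G x s) (add_var G' y s).
Proof.
move=> EG sG sd Hy yG' /wf_add_var_inv[_ xG ws] [wG' Et HS HN]; split.
- by apply: wf_var => //; apply: wf_sch_tdom ws; rewrite Et.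
- by rewrite !tdom_add_var Et EG.
- move=> z t; rewrite /add_var -!cats1.
  case/List.in_app_iff=> [Hz|[[<- <-]|//]]; apply/List.in_app_iff; last first.
    by right; left; rewrite /upd eqxx.
  (* As [x] is fresh for [G], the update of [S] does not touch the names declared in [G]. *)
  left; rewrite /upd; case: eqP => [E|_]; last exact/HS/sG.
  by move: (In_vdom Hz); rewrite E (negPf xG).
- move=> z; rewrite !vdom_add_var !mem_rcons !in_cons => /orP[/eqP ->|/HN].
    by case/orP: Hy => ->; rewrite ?orbT.
  by case/orP=> [/sd|->]; rewrite ?in_cons ?orbT // => ->.
Qed.

(** A binder below [N] cannot clash with the extra target names, so it is fresh for [G'] too: it
    keeps its name and captures nothing. *)
Lemma ctx_renaming_bind N S G G' x s :
  x < N -> wf_ctx (add_var G x s) -> ctx_renaming N S G G' ->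
  avoids S G x /\ ctx_renaming N (upd S x x) (add_var G x s) (add_var G' x s).
Proof.
move=> xN wG HS; have [_ xG _] := wf_add_var_inv wG.
have xG' := ctx_renaming_fresh HS xN xG.
split; first exact: (ctx_renaming_avoids HS).
apply: (ctx_renaming_add_var _ _ _ _ _ _ HS); rewrite ?eqxx //.
by move=> z zG; rewrite in_cons zG orbT.
Qed.

Lemma exists_fresh N (xs : seq nat) : exists2 y, N <= y & y \notin xs.
Proof.
exists (maxn N (\max_(x <- xs) x).+1); first exact: leq_maxl.
apply/negP=> /(leq_bigmax_seq (F := id) (P := xpredT)) /(_ isT).
by rewrite geq_max ltnn andbF.
Qed.

End Contexts.

(** * Elaboration and its typing, by one mutual induction *)

Definition erase_srt (Sg : signature) (R : srt Sg) : irt Sg :=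
  match R with
  | RNone => IRNone
  | RSome als _ A B eps C => IRSome als A B eps C
  end.

(** [N] is fixed by the source derivation, before [S] and [G']: the induction hypothesis can then be
    used at the larger target contexts that [resume] creates. *)
Lemma styp_shtyp_elab (Sg : signature) :
  (forall G R (M : stm Sg) A eps, styp G R M A eps ->
     exists N, forall S G', ctx_renaming N S G G' ->
     exists2 e, elab G R M A eps S e & ityp G' (erase_srt R) e A eps) /\
  (forall G R (H : shdl Sg) A eps B eps', shtyp G R H A eps B eps' ->
     exists N, forall S G', ctx_renaming N S G G' ->
     exists2 h, helab G R H A eps B eps' S h &
                ihtyp G' (erase_srt R) h A eps B eps').
Proof.
apply: styp_shtyp_ind.
- move=> G R x n A Bs eps wG xG sB wB; exists 0 => S G' HS.
  exists (IVar (FV (S x)) Bs); first exact: EL_Var xG sB wB.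
  have [wG' Et HSx _] := HS.
  by apply: IT_Var (HSx _ _ xG) sB _ => //; apply: wf_tys_tdom wB.
- move=> G R c eps wG; exists 0 => S G' [wG' _ _ _].
  by exists (IVal (VConst c)); [apply: EL_Const | apply: IT_Const].
(* The successor puts the bound name [x] strictly below the new bound. *)
- move=> G R x M A B eps' eps TM [N IH]; exists (maxn N x.+1) => S G' HS.
  have [av] := ctx_renaming_bind (leq_maxr _ _) (styp_wf_ctx TM) HS.
  case/(ctx_renaming_le (leq_maxl _ _))/IH=> e Ee Te.
  by exists (IVal (vlam x e)); [apply: EL_Abs | apply: IT_Abs].
- move=> G R M1 M2 A B eps' eps _ [N1 IH1] _ [N2 IH2] le.
  exists (maxn N1 N2) => S G' HS.
  have [e1 E1 T1] := IH1 _ _ (ctx_renaming_le (leq_maxl _ _) HS).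
  have [e2 E2 T2] := IH2 _ _ (ctx_renaming_le (leq_maxr _ _) HS).
  by exists (IApp e1 e2); [apply: EL_App E1 E2 le | apply: IT_App T1 T2 le].
- move=> G R als x M1 M2 A B eps T1 [N1 IH1] T2 [N2 IH2].
  exists (maxn N1 (maxn N2 x.+1)) => S G' HS.
  have HS1 := ctx_renaming_le (leq_maxl _ _) HS.
  have [e1 E1 Te1] := IH1 _ _ (ctx_renaming_add_tvars (styp_wf_ctx T1) HS1).
  have HS2 := ctx_renaming_le (leq_maxr _ _) HS.
  have [av] := ctx_renaming_bind (leq_maxr _ _) (styp_wf_ctx T2) HS2.
  case/(ctx_renaming_le (leq_maxl _ _))/IH2=> e2 E2 Te2.
  by exists (ilet x als e1 e2); [apply: EL_Let E1 E2 | apply: IT_Let Te1 Te2].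
- move=> G R M A eps' eps _ [N IH] le; exists N => S G' /IH[e Ee Te].
  by exists e; [apply: EL_Weak Ee le | apply: IT_Weak Te le].
- move=> G R o Cs M eps sC oe _ [N IH] wC; exists N => S G' HS.
  have [e Ee Te] := IH _ _ HS; have [_ Et _ _] := HS.
  exists (IOp o Cs e); first exact: EL_Op.
  by apply: IT_Op => //; apply: wf_tys_tdom wC.
- move=> G R M H A B eps eps' _ [N1 IH1] _ [N2 IH2].
  exists (maxn N1 N2) => S G' HS.
  have [e Ee Te] := IH1 _ _ (ctx_renaming_le (leq_maxl _ _) HS).
  have [h Eh Th] := IH2 _ _ (ctx_renaming_le (leq_maxr _ _) HS).
  by exists (IHandle e h); [apply: EL_Handle Ee Eh | apply: IT_Handle Te Th].
- move=> G1 G2 als bes x A B eps C D M eps' wG als1 le sb TM [N IH].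
  (* The bound of the body suffices: the target binds not [x] but a name [y] beyond [N], chosen once
     [S] and [G'] are known. *)
  exists N => S G' HS; set G := add_var G1 x (smono D) ++ G2.
  have [y Ny] := exists_fresh N (vdom G ++ vdom G').
  rewrite mem_cat negb_or => /andP[yG yG'].
  have wM := styp_wf_ctx TM; have [wT _ _] := wf_add_var_inv wM.
  have tG : tdom (G1 ++ G2) = tdom G by rewrite !tdom_cat tdom_add_var.
  have [wG' Et HSx HN] := HS.
  have wG'b : wf_ctx (add_tvars G' bes).
    by apply: (wf_add_tvars_tdom _ wG' wT); rewrite Et.
  have wGb : wf_ctx (add_tvars G bes) by apply: (wf_add_tvars_tdom _ wG wT).
  have HS' : ctx_renaming N (upd S x y)
      (add_var (add_tvars (G1 ++ G2) bes) x
         (smono (ty_subst als (tvars bes) A)))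
      (add_var (add_tvars G' bes) y (smono (ty_subst als (tvars bes) A))).
    (* The renaming of all of [G] is extended, old [x] included. Its image stays declared in [G'],
       while [x] now points to [y]; the only source name dropped is [x], which is declared again at
       once. *)
    apply: (ctx_renaming_add_var _ _ _ _ _ wM
              (ctx_renaming_add_tvars wGb HS)).
    + by rewrite !tdom_add_tvars tG.
    + move=> z t; rewrite /add_tvars /G /add_var -cats1 !List.in_app_iff.
      by case=> [[]|]; tauto.
    + move=> z; rewrite !vdom_add_tvars !vdom_cat vdom_add_var.
      by rewrite in_cons !mem_cat mem_rcons in_cons orbA.
    + by rewrite Ny orbT.
    + by rewrite vdom_add_tvars.
  have [e Ee Te] := IH _ _ HS'.
  exists (iresume bes y e).
    by apply: EL_Resume Ee => //; apply: (ctx_renaming_avoids HS).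
  apply: IT_Resume => // a /als1.
  by rewrite Et tdom_cat tdom_add_var mem_cat => ->.
- move=> G R x M A eps B eps' TM [N IH] le; exists (maxn N x.+1) => S G' HS.
  have [av] := ctx_renaming_bind (leq_maxr _ _) (styp_wf_ctx TM) HS.
  case/(ctx_renaming_le (leq_maxl _ _))/IH=> e Ee Te.
  by exists (iret x e); [apply: EL_Ret | apply: IT_Ret].
- move=> G R H o als x M A eps B eps' C D _ [N1 IH1] sa EC ED wr TM [N2 IH2] on.
  exists (maxn N1 (maxn N2 x.+1)) => S G' HS.
  have [h Eh Th] := IH1 _ _ (ctx_renaming_le (leq_maxl _ _) HS).
  have HS2 := ctx_renaming_le (leq_maxr _ _) HS.
  have wM := styp_wf_ctx TM; have [wT _ _] := wf_add_var_inv wM.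
  have [av] := ctx_renaming_bind (leq_maxr _ _) wM
                 (ctx_renaming_add_tvars wT HS2).
  case/(ctx_renaming_le (leq_maxl _ _))/IH2=> e Ee Te.
  exists (iopcl h als o x e); last exact: IT_OpCl Te on.
  by apply: EL_OpCl Ee on => // z zG; apply: av; rewrite vdom_add_tvars.
Qed.

Theorem theorem1 (Sg : signature) (M : stm Sg) (A : ty Sg) :
  styp [::] RNone M A fset0 ->
  exists e : itm Sg,
    elab [::] RNone M A fset0 id e /\ ityp [::] IRNone e A fset0.
Proof.
case/(proj1 (styp_shtyp_elab Sg))=> N HN.
(* Between empty contexts the identity is a renaming for any bound. *)
have [|e Ee Te] := HN id [::]; last by exists e.
by split=> //; apply: wf_nil.
Qed.
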